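(* Let $D$ be a GMPD domain. Then $\mathcal{O}_{ql}(D)=\bigcup_{M\in \operatorname{Max}(D)}\mathcal{O}(D_{M})$.
   Context: All rings are commutative unitary integral domains. A ring is quasi-local if it has exactly one maximal ideal (no Noetherian assumption). For an integral domain $D$ with quotient field $K$, an overring of $D$ is a subring of $K$ containing $D$; $\mathcal{O}(D)$ is the set of all overrings of $D$ and $\mathcal{O}_{ql}(D)$ is the set of those overrings of $D$ which are quasi-local. $\operatorname{Max}(D)$ is the set of maximal ideals of $D$; localizations $D_M$ are regarded as subrings of $K$. $D$ is h-local if each nonzero ideal of $D$ is contained in only finitely many maximal ideals and each nonzero prime ideal is contained in a unique maximal ideal. An MNI ideal of $D$ is an ideal of $D$ which is maximal (under inclusion) among the non-invertible ideals of $D$ (the zero ideal counts as non-invertible). $D$ is an MPD domain if it has a unique MNI ideal $Q$ and every nonzero non-invertible ideal of $D$ can be written as $JQ$ for some invertible ideal $J$ of $D$. $D$ is a GMPD domain (globalized multiplicatively pinched-Dedekind domain) if $D$ is h-local and the localization $D_M$ is an MPD domain for every maximal ideal $M$ of $D$. *)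

(* Defs.v *)
(* MathComp world, with the classical sets of MathComp-Analysis. *)
From HB Require Import structures.
From mathcomp Require Import all_boot all_order all_algebra.
From mathcomp Require Import all_classical.

Set Implicit Arguments.
Unset Strict Implicit.
Unset Printing Implicit Defensive.

Import GRing.Theory.
Local Open Scope classical_set_scope.
Local Open Scope ring_scope.

(* An integral domain is given as a subring D of a field K which is its        *)
(* quotient field (is_quotient_field below). Overrings and localizations of D  *)
(* are then again subsets of K, with the same quotient field K.                *)

Definition is_subring (K : fieldType) (A : set K) : Prop :=
  GRing.subring_closed (mem A).

Definition is_quotient_field (K : fieldType) (A : set K) : Prop :=
  forall x : K, exists a b : K, [/\ A a, A b, b != 0 & x = a / b].

Definition is_submodule (K : fieldType) (A I : set K) : Prop :=
  [/\ I 0, forall x y, I x -> I y -> I (x + y)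
    & forall a x, A a -> I x -> I (a * x)].

Definition is_ideal (K : fieldType) (A I : set K) : Prop :=
  I `<=` A /\ is_submodule A I.

Definition is_fractional_ideal (K : fieldType) (A J : set K) : Prop :=
  is_submodule A J /\
  exists d : K, [/\ A d, d != 0 & forall x, J x -> A (d * x)].

Definition ideal_mul (K : fieldType) (I J : set K) : set K :=
  [set x | exists (n : nat) (a b : 'I_n -> K),
     [/\ forall i, I (a i), forall i, J (b i) & x = \sum_(i < n) a i * b i]].

Definition is_invertible (K : fieldType) (A I : set K) : Prop :=
  exists J : set K, is_fractional_ideal A J /\ ideal_mul I J = A.

Definition is_prime_ideal (K : fieldType) (A P : set K) : Prop :=
  [/\ is_ideal A P, P <> A
    & forall x y, A x -> A y -> P (x * y) -> P x \/ P y].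

Definition is_maximal_ideal (K : fieldType) (A M : set K) : Prop :=
  [/\ is_ideal A M, M <> A
    & forall I : set K, is_ideal A I -> M `<=` I -> I <> A -> I = M].

Definition Max (K : fieldType) (A : set K) : set (set K) :=
  [set M | is_maximal_ideal A M].

Definition is_quasi_local (K : fieldType) (A : set K) : Prop :=
  exists! M : set K, is_maximal_ideal A M.

Definition localization (K : fieldType) (A M : set K) : set K :=
  [set x | exists a s : K, [/\ A a, A s, ~ M s & x = a / s]].

(* The overrings of A, provided that K is the quotient field of A. *)
Definition overrings (K : fieldType) (A : set K) : set (set K) :=
  [set B | is_subring B /\ A `<=` B].

Definition ql_overrings (K : fieldType) (A : set K) : set (set K) :=
  [set B | overrings A B /\ is_quasi_local B].

Definition is_hlocal (K : fieldType) (A : set K) : Prop :=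
  (forall I : set K, is_ideal A I -> I <> [set 0] ->
     finite_set [set M | Max A M /\ I `<=` M]) /\
  (forall P : set K, is_prime_ideal A P -> P <> [set 0] ->
     exists! M : set K, Max A M /\ P `<=` M).

Definition is_MNI (K : fieldType) (A Q : set K) : Prop :=
  [/\ is_ideal A Q, ~ is_invertible A Q
    & forall I : set K,
        is_ideal A I -> ~ is_invertible A I -> Q `<=` I -> I = Q].

Definition is_MPD (K : fieldType) (A : set K) : Prop :=
  exists Q : set K,
    [/\ is_MNI A Q, forall Q' : set K, is_MNI A Q' -> Q' = Q
      & forall I : set K,
          is_ideal A I -> I <> [set 0] -> ~ is_invertible A I ->
          exists J : set K,
            [/\ is_ideal A J, is_invertible A J & I = ideal_mul J Q]].

Definition is_GMPD (K : fieldType) (A : set K) : Prop :=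
  is_hlocal A /\ forall M : set K, Max A M -> is_MPD (localization A M).

(* Main.v *)
Require Import Defs.
From HB Require Import structures.
From mathcomp Require Import all_boot all_order all_algebra.
From mathcomp Require Import all_classical.
From mathcomp Require Import ring.

Set Implicit Arguments.
Unset Strict Implicit.
Unset Printing Implicit Defensive.

Import GRing.Theory.
Local Open Scope classical_set_scope.
Local Open Scope ring_scope.

(** A quasi-local overring [B] of [D] contains a localization of [D] at a
maximal ideal for any domain [D]: the maximal ideal of [B] contracts to a
prime ideal [P] of [D], and [D_M <= D_P <= B] when [M] is a maximal ideal
containing [P] ([quasi_local_overring_localization]).

The MPD property gives the converse: every overring of a local MPD domain [A]
is local ([pinched_overring_local]). In a local ring invertible ideals are
principal, so a nonzero ideal of [A] is either principal or [c Q] with [c] in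
[A]. Let [m] be the maximal ideal of [A].

If [m Q = Q], then by Nakayama's lemma no [c Q] with [c <> 0] is a
nonprincipal ideal with two generators. All such ideals are then principal,
so [A] is a valuation ring, as are its overrings
([pinched_nakayama_valuation]).

If [m Q <> Q], then [Q = m] and [m * m = d m] for some [d] in [m]
([pinched_square]). It follows that [V = d^-1 m] is the ring [m : m], and that
it is a valuation ring with the same maximal ideal [m = d V]
([pinched_square_valuation]). The overrings of [A] are then [A], [V] and
overrings of [V], all of them local. *)

(** * Subrings of a field, their units and their maximal ideals *)

Lemma subring1 (K : fieldType) (A : set K) : is_subring A -> A 1.
Proof. by case=> A1 _ _; apply: set_mem. Qed.

Lemma subringB (K : fieldType) (A : set K) x y :
  is_subring A -> A x -> A y -> A (x - y).
Proof. by case=> _ AB _ Ax Ay; apply: set_mem; apply: AB; apply: mem_set. Qed.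

Lemma subringM (K : fieldType) (A : set K) x y :
  is_subring A -> A x -> A y -> A (x * y).
Proof. by case=> _ _ AM Ax Ay; apply: set_mem; apply: AM; apply: mem_set. Qed.

Lemma subring0 (K : fieldType) (A : set K) : is_subring A -> A 0.
Proof. by move=> Ar; rewrite -(subrr 1); apply: subringB => //; exact: subring1. Qed.

Lemma subringN (K : fieldType) (A : set K) x : is_subring A -> A x -> A (- x).
Proof. by move=> Ar Ax; rewrite -sub0r; apply: subringB => //; exact: subring0. Qed.

Lemma subringD (K : fieldType) (A : set K) x y :
  is_subring A -> A x -> A y -> A (x + y).
Proof. by move=> Ar Ax Ay; rewrite -[y]opprK; apply: subringB => //; exact: subringN. Qed.

Lemma subring_of_laws (K : fieldType) (A : set K) :
  A 1 -> (forall x y, A x -> A y -> A (x - y)) ->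
  (forall x y, A x -> A y -> A (x * y)) -> is_subring A.
Proof.
move=> A1 AB AM; split; first exact: mem_set.
- by move=> x y /set_mem Ax /set_mem Ay; apply: mem_set; apply: AB.
- by move=> x y /set_mem Ax /set_mem Ay; apply: mem_set; apply: AM.
Qed.

Lemma quotient_field_subset (K : fieldType) (A B : set K) :
  A `<=` B -> is_quotient_field A -> is_quotient_field B.
Proof.
move=> AB KA x; have [a [b [Aa Ab b0 ->]]] := KA x.
by exists a, b; split=> //; apply: AB.
Qed.

Lemma ideal_full (K : fieldType) (A I : set K) : is_ideal A I -> I 1 -> I = A.
Proof.
case=> IA [_ _ IM] I1; apply/seteqP; split=> // x Ax.
by rewrite -[x]mulr1; apply: IM.
Qed.

Definition units (K : fieldType) (A : set K) : set K :=
  [set x | [/\ x != 0, A x & A x^-1]].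

Definition nonunits (K : fieldType) (A : set K) : set K := A `\` units A.

Lemma proper_ideal_nonunits (K : fieldType) (A I : set K) :
  is_ideal A I -> ~ I 1 -> I `<=` nonunits A.
Proof.
move=> [IA [_ _ IM]] I1 x Ix; split; first exact: IA.
by case=> x0 _ Ax'; apply: I1; rewrite -(mulVf x0); apply: IM.
Qed.

Lemma principal_ideal (K : fieldType) (A : set K) c :
  is_subring A -> A c -> is_ideal A [set x | exists2 a, A a & x = a * c].
Proof.
move=> Ar Ac; split=> [_ [a Aa ->]|]; first exact: subringM.
split.
- by exists 0; [exact: subring0 | rewrite mul0r].
- by move=> _ _ [a Aa ->] [b Ab ->]; exists (a + b); [exact: subringD | rewrite mulrDl].
- by move=> x _ Ax [a Aa ->]; exists (x * a); [exact: subringM | rewrite mulrA].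
Qed.

(** Zorn's lemma on the proper ideals containing [I]; the empty set is added
to them because it is the union of the empty chain. *)
Lemma exists_maximal_ideal (K : fieldType) (A I : set K) :
  is_subring A -> is_ideal A I -> ~ I 1 -> exists2 M, Max A M & I `<=` M.
Proof.
move=> Ar idI I1.
pose P (X : set K) := X = set0 \/ [/\ is_ideal A X, ~ X 1 & I `<=` X].
have [F FP tF|M [PM maxM]] := @Zorn_bigcup K P.
  have [noX|/existsNP[X /not_implyP[FX X0]]] :=
      pselect (forall X, F X -> X = set0).
    by left; rewrite -subset0 => x [X /noX ->].
  have ideal_of Y y : F Y -> Y y -> [/\ is_ideal A Y, ~ Y 1 & I `<=` Y].
    by move=> /FP[->|//].
  have [[_ [XZ _ _]] _ IX] : [/\ is_ideal A X, ~ X 1 & I `<=` X].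
    by case: (FP _ FX) => // /X0.
  right; split; last by move=> x /IX Xx; exists X.
  - split=> [x [Y FY Yx]|].
      by case: (ideal_of _ _ FY Yx) => -[YA _] _ _; apply: YA.
    split; first by exists X.
    + move=> x y [Y FY Yx] [Z FZ Zy].
      have [[_ [_ YD _]] _ _] := ideal_of _ _ FY Yx.
      have [[_ [_ ZD _]] _ _] := ideal_of _ _ FZ Zy.
      have [YZ|ZY] := tF _ _ FY FZ.
      * by exists Z => //; apply: ZD => //; apply: YZ.
      * by exists Y => //; apply: YD => //; apply: ZY.
    + move=> a x Aa [Y FY Yx]; exists Y => //.
      by have [[_ [_ _ YM]] _ _] := ideal_of _ _ FY Yx; apply: YM.
  - by move=> [Y FY Y1]; have [] := ideal_of _ _ FY Y1.
have [idM M1 IM] : [/\ is_ideal A M, ~ M 1 & I `<=` M].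
  case: PM => // M0; exfalso; apply: (maxM I); last by right; split.
  rewrite M0; split=> [x|] // /(_ 0) /=; apply.
  by case: idI => _ [].
exists M => //; split=> //.
  by move=> MA; apply: M1; rewrite MA; apply: subring1.
move=> J idJ MJ JA; apply: contrapT => JM; apply: (maxM J).
  by split=> // JM'; apply: JM; apply/seteqP.
right; split=> //; last exact: subset_trans MJ.
by move=> J1; apply: JA; apply: ideal_full.
Qed.

Lemma maximal_prime (K : fieldType) (A M : set K) x y :
  is_subring A -> Max A M -> A x -> A y -> M (x * y) -> M x \/ M y.
Proof.
move=> Ar [[MA [M0 MD MM]] MnA maxM] Ax Ay Mxy.
have [|nMx] := pselect (M x); [by left | right].
pose J := [set z | exists m a, [/\ M m, A a & z = m + a * x]].
have idJ : is_ideal A J.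
  split=> [_ [m [a [Mm Aa ->]]]|].
    by apply: subringD => //; [exact: MA | exact: subringM].
  split.
  - by exists 0, 0; split=> //; [exact: subring0 | rewrite mul0r addr0].
  - move=> _ _ [m [a [Mm Aa ->]]] [n [b [Mn Ab ->]]].
    by exists (m + n), (a + b); split; [exact: MD | exact: subringD | ring].
  - move=> b _ Ab [m [a [Mm Aa ->]]].
    by exists (b * m), (b * a); split; [exact: MM | exact: subringM | ring].
have [m [a [Mm Aa E1]]] : J 1.
  have [JA|nJA] := pselect (J = A); first by rewrite JA; exact: subring1.
  case: nMx; rewrite -(maxM J idJ _ nJA) => [|z Mz].
    by exists 0, 1; split=> //; [exact: subring1 | rewrite mul1r add0r].
  by exists z, 0; split=> //; [exact: subring0 | rewrite mul0r addr0].
have -> : y = y * m + a * (x * y) by rewrite -[LHS]mulr1 E1; ring.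
by apply: MD; apply: MM.
Qed.

(** * Local rings and valuation rings *)

(** The elementary form of having a unique maximal ideal. *)
Definition local (K : fieldType) (A : set K) : Prop :=
  forall x, A x -> units A x \/ units A (1 - x).

Lemma nonunits_ideal (K : fieldType) (A : set K) :
  is_subring A -> local A -> is_ideal A (nonunits A).
Proof.
move=> Ar Al; split=> [x []//|].
split.
- by split; [exact: subring0 | rewrite /units /= eqxx; case].
- move=> x y [Ax nx] [Ay ny]; split; first exact: subringD.
  case=> u0 Au Au'.
  have unitl z : A z -> units A (z / (x + y)) -> units A z.
    move=> Az [zu0 _]; rewrite invfM invrK => Auz.
    have z0 : z != 0 by apply: contra_neq zu0 => ->; rewrite mul0r.
    split=> //; rewrite -[z^-1](mulfK u0); exact: subringM.
  case: (Al (x / (x + y))); first exact: subringM.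
    by move/(unitl x Ax).
  have -> : 1 - x / (x + y) = y / (x + y) by field.
  by move/(unitl y Ay).
- move=> a x Aa [Ax nx]; split; first exact: subringM.
  case=> ax0 _; rewrite invfM => Aax'; apply: nx.
  move: ax0; rewrite mulf_eq0 negb_or => /andP[a0 x0]; split=> //.
  have -> : x^-1 = a * (a^-1 / x) by field; rewrite a0 x0.
  exact: subringM.
Qed.

Lemma nonunits1 (K : fieldType) (A : set K) : is_subring A -> ~ nonunits A 1.
Proof.
by move=> Ar [_]; apply; split; rewrite ?invr1 ?oner_neq0 //; exact: subring1.
Qed.

Lemma local_quasi_local (K : fieldType) (A : set K) :
  is_subring A -> local A -> is_quasi_local A.
Proof.
move=> Ar Al; have idN := nonunits_ideal Ar Al.
have NnA : nonunits A <> A.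
  by move=> NA; apply: (nonunits1 Ar); rewrite NA; exact: subring1.
have properN J : is_ideal A J -> J <> A -> J `<=` nonunits A.
  by move=> idJ JA; apply: proper_ideal_nonunits => // /(ideal_full idJ).
exists (nonunits A); split.
  split=> // J idJ NJ JA; apply/seteqP; split=> //; exact: properN.
by move=> M [idM MA maxM]; apply: maxM => //; apply: properN.
Qed.

Lemma localization_subring (K : fieldType) (D M : set K) :
  is_subring D -> Max D M -> is_subring (localization D M).
Proof.
move=> Dr mM; have [[_ [M0 _ _]] MD _] := mM.
have M1 : ~ M 1 by case: mM => idM _ _ /(ideal_full idM).
have nz s : ~ M s -> s != 0 by move=> Ms; apply/eqP => s0; rewrite s0 in Ms.
have nM s t : D s -> D t -> ~ M s -> ~ M t -> ~ M (s * t).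
  by move=> Ds Dt Ms Mt /(maximal_prime Dr mM Ds Dt)[].
apply: subring_of_laws.
- by exists 1, 1; split=> //; rewrite ?invr1 ?mulr1 //; exact: subring1.
- move=> _ _ [a [s [Da Ds Ms ->]]] [b [t [Db Dt Mt ->]]].
  exists (a * t - b * s), (s * t); split; last by field; rewrite !nz.
  + by apply: subringB => //; exact: subringM.
  + exact: subringM.
  + exact: nM.
- move=> _ _ [a [s [Da Ds Ms ->]]] [b [t [Db Dt Mt ->]]].
  exists (a * b), (s * t); split; last by field; rewrite !nz.
  + exact: subringM.
  + exact: subringM.
  + exact: nM.
Qed.

Lemma localization_local (K : fieldType) (D M : set K) :
  is_subring D -> Max D M -> local (localization D M).
Proof.
move=> Dr mM _ [a [s [Da Ds Ms ->]]].
have [[_ [M0 MD _]] _ _] := mM.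
have nz t : ~ M t -> t != 0 by move=> Mt; apply/eqP => t0; rewrite t0 in Mt.
have unit_frac b : D b -> ~ M b -> units (localization D M) (b / s).
  move=> Db Mb; split.
  - by rewrite mulf_neq0 ?invr_eq0 ?nz.
  - by exists b, s.
  - by exists s, b; split=> //; rewrite invfM invrK mulrC.
have [Ma|] := pselect (M a); last by left; exact: unit_frac.
right; have -> : 1 - a / s = (s - a) / s by field; exact: nz.
apply: unit_frac; first exact: subringB.
by move=> Msa; apply: Ms; rewrite -[s](subrK a); exact: MD.
Qed.

Lemma localization_superset (K : fieldType) (D M : set K) :
  is_subring D -> Max D M -> D `<=` localization D M.
Proof.
move=> Dr [idM MD _] x Dx; exists x, 1; split=> //; rewrite ?divr1 //.
  exact: subring1.
by move/(ideal_full idM).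
Qed.

Definition valuation (K : fieldType) (V : set K) : Prop :=
  forall x, V x \/ V x^-1.

Lemma valuation_overring (K : fieldType) (V B : set K) :
  valuation V -> V `<=` B -> valuation B.
Proof. by move=> Vv VB x; case: (Vv x) => /VB; [left|right]. Qed.

Lemma valuation_local (K : fieldType) (V : set K) :
  is_subring V -> valuation V -> local V.
Proof.
move=> Vr Vv x Vx; have V1 := subring1 Vr.
have [->|x0] := eqVneq x 0.
  by right; rewrite subr0; split; rewrite ?invr1 ?oner_neq0.
have [y0|y0] := eqVneq (1 - x) 0.
  by left; rewrite -(subr0_eq y0); split; rewrite ?invr1 ?oner_neq0.
case: (Vv (x / (1 - x))) => Vq; [right | left]; split=> //.
- exact: subringB.
- have -> : (1 - x)^-1 = 1 + x / (1 - x) by field.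
  exact: subringD.
- have -> : x^-1 = 1 + (x / (1 - x))^-1 by field; rewrite x0 y0.
  exact: subringD.
Qed.

(** * Principal ideals *)

Definition scale (K : fieldType) (c : K) (I : set K) : set K :=
  [set x | I (x / c)].

Lemma ideal_mul_mem (K : fieldType) (I J : set K) a b :
  I a -> J b -> ideal_mul I J (a * b).
Proof.
move=> Ia Jb; exists 1%N, (fun=> a), (fun=> b); split=> //.
by rewrite big_ord1.
Qed.

Lemma ideal_mul_sub (K : fieldType) (I J S : set K) :
  S 0 -> (forall x y, S x -> S y -> S (x + y)) ->
  (forall a b, I a -> J b -> S (a * b)) -> ideal_mul I J `<=` S.
Proof.
move=> S0 SD SM _ [n [a [b [Ia Jb ->]]]].
by apply: (big_ind S) => // i _; exact: SM.
Qed.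

Lemma ideal_mulD (K : fieldType) (I J : set K) x y :
  ideal_mul I J x -> ideal_mul I J y -> ideal_mul I J (x + y).
Proof.
move=> [n [a [b [Ia Jb ->]]]] [p [c [d [Ic Jd ->]]]].
exists (n + p)%N,
  (fun i : 'I_(n + p) => match fintype.split i with inl j => a j | inr k => c k end),
  (fun i : 'I_(n + p) => match fintype.split i with inl j => b j | inr k => d k end).
split=> [i|i|]; [by case: fintype.split..|].
rewrite big_split_ord /=; congr (_ + _); apply: eq_bigr => i _.
  by rewrite (unsplitK (inl i)).
by rewrite (unsplitK (inr i)).
Qed.

Lemma ideal_mul_ideal (K : fieldType) (A I J : set K) :
  is_subring A -> is_ideal A I -> is_ideal A J -> is_ideal A (ideal_mul I J).
Proof.
move=> Ar [IA [I0 _ IM]] [JA [J0 _ _]]; split.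
  apply: ideal_mul_sub => [|x y|a b /IA Aa /JA]; first exact: subring0.
    exact: subringD.
  exact: subringM.
split; first by rewrite -(mulr0 0); exact: ideal_mul_mem.
  by move=> x y; exact: ideal_mulD.
move=> a x Aa; apply: (ideal_mul_sub (S := [set x | ideal_mul I J (a * x)])).
- by rewrite /= -(mulr0 0) mulrA; apply: ideal_mul_mem => //; exact: IM.
- by move=> y z /=; rewrite mulrDr; exact: ideal_mulD.
- by move=> y z Iy Jz; rewrite /= mulrA; apply: ideal_mul_mem => //; exact: IM.
Qed.

Lemma submodule_restrict (K : fieldType) (A V I : set K) :
  A `<=` V -> is_submodule V I -> is_submodule A I.
Proof. by move=> AV [I0 ID IM]; split=> // a x /AV; exact: IM. Qed.

Lemma scale_submodule (K : fieldType) (A I : set K) c :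
  is_submodule A I -> is_submodule A (scale c I).
Proof.
move=> [I0 ID IM]; split.
- by rewrite /scale /= mul0r.
- by move=> x y; rewrite /scale /= mulrDl; exact: ID.
- by move=> a x Aa; rewrite /scale /= -mulrA; exact: IM.
Qed.

Lemma subring_submodule (K : fieldType) (A : set K) :
  is_subring A -> is_submodule A A.
Proof.
move=> Ar; split; first exact: subring0.
  by move=> x y; exact: subringD.
by move=> x y; exact: subringM.
Qed.

Lemma scale_scale (K : fieldType) (a b : K) (I : set K) :
  scale a (scale b I) = scale (a * b) I.
Proof.
by apply/seteqP; split=> x; rewrite /scale /= invfM mulrA.
Qed.

Lemma scale1 (K : fieldType) (I : set K) : scale 1 I = I.
Proof. by apply/seteqP; split=> x; rewrite /scale /= divr1. Qed.

Lemma scaleVK (K : fieldType) (c : K) (I : set K) :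
  c != 0 -> scale c (scale c^-1 I) = I.
Proof. by move=> c0; rewrite scale_scale divff // scale1. Qed.

Lemma scaleKV (K : fieldType) (c : K) (I : set K) :
  c != 0 -> scale c^-1 (scale c I) = I.
Proof. by move=> c0; rewrite scale_scale mulVf // scale1. Qed.

Lemma scale_base (K : fieldType) (A : set K) c :
  is_subring A -> c != 0 -> scale c A c.
Proof. by move=> Ar c0; rewrite /scale /= divff //; exact: subring1. Qed.

Lemma scale_unit (K : fieldType) (A I : set K) u :
  is_submodule A I -> units A u -> scale u I = I.
Proof.
move=> [_ _ IM] [u0 Au Au']; apply/seteqP; split=> x; rewrite /scale /= => Ix.
  by rewrite -(divfK u0 x) mulrC; exact: IM.
by rewrite mulrC; exact: IM.
Qed.

Lemma ideal_mul_scale (K : fieldType) (A I : set K) c :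
  is_subring A -> is_submodule A I -> c != 0 ->
  ideal_mul (scale c A) I = scale c I.
Proof.
move=> Ar sI c0; have [I0 ID IM] := sI; apply/seteqP; split.
  have [S0 SD SM] := scale_submodule c sI.
  apply: ideal_mul_sub => // a b; rewrite /scale /= => Aac Ib.
  by rewrite mulrAC; exact: IM.
move=> x Ix; rewrite -(divfK c0 x) mulrC; apply: ideal_mul_mem => //.
exact: scale_base.
Qed.

Lemma ideal_mul_scaler (K : fieldType) (I J : set K) c :
  J 0 -> I 0 -> c != 0 -> ideal_mul I (scale c J) = scale c (ideal_mul I J).
Proof.
move=> J0 I0 c0; have IJ0 (L : set K) : L 0 -> ideal_mul I L 0.
  by move=> L0; rewrite -(mulr0 0); exact: ideal_mul_mem.
apply/seteqP; split.
  apply: ideal_mul_sub.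
  - by rewrite /scale /= mul0r; exact: IJ0.
  - by move=> x y; rewrite /scale /= mulrDl; exact: ideal_mulD.
  - by move=> a b Ia Jb; rewrite /scale /= -mulrA; exact: ideal_mul_mem.
suff sub : ideal_mul I J `<=` [set w | ideal_mul I (scale c J) (w * c)].
  by move=> x /sub; rewrite /= divfK.
apply: ideal_mul_sub.
- by rewrite /= mul0r; apply: IJ0; rewrite /scale /= mul0r.
- by move=> x y /=; rewrite mulrDl; exact: ideal_mulD.
- move=> a b Ia Jb; rewrite /= -mulrA; apply: ideal_mul_mem => //.
  by rewrite /scale /= mulfK.
Qed.

Lemma scale_invertible (K : fieldType) (A : set K) c :
  is_subring A -> is_ideal A (scale c A) -> c != 0 ->
  is_invertible A (scale c A).
Proof.
move=> Ar [cA _] c0; have sA := subring_submodule Ar.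
exists (scale c^-1 A); split; last first.
  by rewrite (ideal_mul_scale Ar) ?scaleVK //; exact: scale_submodule.
split; first exact: scale_submodule.
exists c; split=> //; first by apply: cA; exact: scale_base.
by move=> x; rewrite /scale /= invrK mulrC.
Qed.

(** If [I J = A], then 1 is a sum of products [a b] of elements of [I] and
[J]; in a local ring one of these products is a unit, and then [a]
generates [I]. *)
Lemma invertible_principal (K : fieldType) (A I : set K) :
  is_subring A -> local A -> is_submodule A I -> is_invertible A I ->
  exists2 c, c != 0 & I = scale c A.
Proof.
move=> Ar Al [_ _ IM] [J [_ IJA]].
have [_ [N0 ND _]] := nonunits_ideal Ar Al.
have [a [b [Ia Jb [ab0 Aab Aab']]]] :
    exists a b, [/\ I a, J b & units A (a * b)].
  apply: contrapT => no; apply: (nonunits1 Ar).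
  apply: (ideal_mul_sub (I := I) (J := J)) => //; last first.
    by rewrite IJA; exact: subring1.
  move=> a b Ia Jb; split; first by rewrite -IJA; exact: ideal_mul_mem.
  by move=> uab; apply: no; exists a, b.
move: ab0; rewrite mulf_eq0 negb_or => /andP[a0 b0].
exists a => //; apply/seteqP; split=> x; rewrite /scale /= => Ix.
  have -> : x / a = x * b * (a * b)^-1 by field; rewrite a0 b0.
  by apply: subringM => //; rewrite -IJA; exact: ideal_mul_mem.
by rewrite -(divfK a0 x); exact: IM.
Qed.

(** * Local MPD domains *)

(** In a local ring the invertible ideals are the nonzero principal ones, so
this is the MPD property of a local ring [A] in terms of generators. It
matters below that the factor [c] of a nonprincipal ideal lies in [A]: with
[c] in [K], the local ring of a plane curve at a node would qualify, and its
normalization is an overring with two maximal ideals. *)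
Definition pinched (K : fieldType) (A Q : set K) : Prop :=
  [/\ is_ideal A Q, forall c, c != 0 -> Q <> scale c A,
      forall I, is_ideal A I -> Q `<=` I ->
        I = Q \/ exists2 c, c != 0 & I = scale c A
    & forall I, is_ideal A I -> I <> [set 0] ->
        (exists2 c, c != 0 & I = scale c A) \/
        exists c, [/\ A c, c != 0 & I = scale c Q]].

Lemma MPD_pinched (K : fieldType) (A : set K) :
  is_subring A -> local A -> is_MPD A -> exists Q, pinched A Q.
Proof.
move=> Ar Al [Q [[idQ nQ maxQ] _ decQ]]; exists Q; split=> //.
- by move=> c c0 QE; apply: nQ; rewrite QE; apply: scale_invertible; rewrite -?QE.
- move=> I idI QI; have [inv|ninv] := pselect (is_invertible A I).
    by right; apply: invertible_principal => //; case: idI.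
  by left; exact: maxQ.
- move=> I idI I0; have [inv|ninv] := pselect (is_invertible A I).
    by left; apply: invertible_principal => //; case: idI.
  right; have [J [[JA sJ] invJ ->]] := decQ I idI I0 ninv.
  have [c c0 JE] := invertible_principal Ar Al sJ invJ.
  exists c; split=> //; first by apply: JA; rewrite JE; exact: scale_base.
  by rewrite JE (ideal_mul_scale Ar) //; case: idQ.
Qed.

Definition pair_ideal (K : fieldType) (A : set K) (x y : K) : set K :=
  [set z | exists r s, [/\ A r, A s & z = r * x + s * y]].

Lemma pair_ideal_submodule (K : fieldType) (A : set K) x y :
  is_subring A -> is_submodule A (pair_ideal A x y).
Proof.
move=> Ar; have A0 := subring0 Ar; split.
- by exists 0, 0; split=> //; rewrite !mul0r addr0.
- move=> _ _ [r [s [Ar' As ->]]] [t [u [At Au ->]]].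
  by exists (r + t), (s + u); split; [exact: subringD..|ring].
- move=> a _ Aa [r [s [Ar' As ->]]].
  by exists (a * r), (a * s); split; [exact: subringM..|ring].
Qed.

Lemma pair_ideal_left (K : fieldType) (A : set K) x y :
  is_subring A -> pair_ideal A x y x.
Proof.
by move=> Ar; exists 1, 0; split; [exact: subring1|exact: subring0|ring].
Qed.

Lemma pair_ideal_right (K : fieldType) (A : set K) x y :
  is_subring A -> pair_ideal A x y y.
Proof.
by move=> Ar; exists 0, 1; split; [exact: subring0|exact: subring1|ring].
Qed.

Lemma pair_ideal_sub (K : fieldType) (A I : set K) x y :
  is_submodule A I -> I x -> I y -> pair_ideal A x y `<=` I.
Proof.
by move=> [_ ID IM] Ix Iy _ [r [s [Ar As ->]]]; apply: ID; exact: IM.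
Qed.

(** If [x = c x'], [y = c y'] and [c = r x + s y], then [1 = r x' + s y'], so
that one of [x'], [y'] is a unit, and [x] divides [y] or conversely. *)
Lemma local_bezout_valuation (K : fieldType) (A : set K) :
  is_subring A -> local A -> is_quotient_field A ->
  (forall x y, A x -> A y -> x != 0 -> y != 0 ->
     exists2 c, c != 0 & pair_ideal A x y = scale c A) ->
  valuation A.
Proof.
move=> Ar Al KA bez z.
have [x [y [Ax Ay y0 ->]]] := KA z.
have [->|x0] := eqVneq x 0; first by left; rewrite mul0r; exact: subring0.
have [c c0 E] := bez x y Ax Ay x0 y0.
have Axc : A (x / c) by have := pair_ideal_left x y Ar; rewrite E.
have Ayc : A (y / c) by have := pair_ideal_right x y Ar; rewrite E.
have [r [s [Ar' As Ec]]] : pair_ideal A x y c by rewrite E; exact: scale_base.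
have unit_div a b d : A d -> units A (a * (b / c)) -> A a -> b != 0 ->
    A (d / c) -> A (d / b).
  move=> Ad [u0 _ Au'] Aa b0 Adc.
  have a0 : a != 0 by apply: contra_neq u0 => ->; rewrite mul0r.
  have -> : d / b = d / c * a * (a * (b / c))^-1.
    by field; rewrite a0 b0 c0.
  by do 2?apply: subringM.
case: (Al (r * (x / c))); first exact: subringM.
  by move=> u; right; rewrite invfM invrK mulrC; exact: (unit_div r).
have -> : 1 - r * (x / c) = s * (y / c).
  by rewrite -(divff c0) {1}Ec; field.
by move=> u; left; exact: (unit_div s).
Qed.

(** Nakayama's argument: the condition on [Q] writes [x] as [p x + q y] with
[p] and [q] nonunits, and [1 - p] is a unit. *)
Lemma pair_nakayama (K : fieldType) (A Q : set K) x y c :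
  is_subring A -> local A -> Q `<=` ideal_mul (nonunits A) Q -> c != 0 ->
  pair_ideal A x y = scale c Q -> exists2 u, A u & x = u * y.
Proof.
move=> Ar Al QmQ c0 E.
have [_ [N0 ND NM]] := nonunits_ideal Ar Al.
pose S := [set w | exists p q, [/\ nonunits A p, nonunits A q
                                  & w * c = p * x + q * y]].
have QS : Q `<=` S.
  apply: subset_trans QmQ _; apply: ideal_mul_sub.
  - by exists 0, 0; split=> //; ring.
  - move=> w w' [p [q [Np Nq E1]]] [p' [q' [Np' Nq' E2]]].
    exists (p + p'), (q + q'); split; [by apply: ND|by apply: ND|].
    by rewrite mulrDl E1 E2; ring.
  - move=> a b Na Qb.
    have [r [s [Ar' As E1]]] : pair_ideal A x y (b * c).
      by rewrite E /scale /= mulfK.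
    exists (r * a), (s * a); split; [by apply: NM|by apply: NM|].
    by rewrite -mulrA E1; ring.
have [p [q [[Ap nup] [Aq _]]]] : S (x / c).
  by apply: QS; have := pair_ideal_left x y Ar; rewrite E.
rewrite divfK // => Ex.
case: (Al p Ap) => [/nup//|[p0 Ap1 Ap1']].
exists (q / (1 - p)); first exact: subringM.
have : x * (1 - p) = q * y by rewrite mulrBr mulr1 {1}Ex; ring.
by move/(canRL (mulfK p0)) => ->; ring.
Qed.

Lemma pinched_nakayama_valuation (K : fieldType) (A Q : set K) :
  is_subring A -> local A -> is_quotient_field A -> pinched A Q ->
  Q `<=` ideal_mul (nonunits A) Q -> valuation A.
Proof.
move=> Ar Al KA [_ _ _ decQ] QmQ; apply: local_bezout_valuation => // x y Ax Ay x0 y0.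
have sP := pair_ideal_submodule x y Ar.
case: (decQ (pair_ideal A x y)) => //.
- split=> //; apply: pair_ideal_sub => //; exact: subring_submodule.
- move=> P0; have := pair_ideal_left x y Ar.
  by rewrite P0 => /= xE; rewrite xE eqxx in x0.
move=> [c [_ c0 E]]; exists y => //.
have [u Au xE] := pair_nakayama Ar Al QmQ c0 E.
have sY := scale_submodule y (subring_submodule Ar).
apply/seteqP; split.
  apply: pair_ideal_sub => //; first by rewrite /scale /= xE mulfK.
  exact: scale_base.
move=> z Az; rewrite -(divfK y0 z); case: sP => _ _; apply=> //.
exact: pair_ideal_right.
Qed.

(** If the maximal ideal is [t A], then [t^-1 Q] is a nonprincipal ideal
containing [Q], so that [Q = t Q]. Hence a [Q] with [Q <> m Q] must be the
maximal ideal [m]. Then [m * m] is not principal, since [m] would be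
invertible, so it is [d m] with [d] in [A], and [d] is not a unit since
[m * m <> m]. *)
Lemma pinched_square (K : fieldType) (A Q : set K) :
  is_subring A -> local A -> pinched A Q ->
  ~ Q `<=` ideal_mul (nonunits A) Q ->
  Q = nonunits A /\
  exists d, [/\ nonunits A d, d != 0 & ideal_mul Q Q = scale d Q].
Proof.
move=> Ar Al [idQ nprQ maxQ decQ] nQ.
have [QA [Q0 QD QM]] := idQ; have sQ := proj2 idQ.
have idN := nonunits_ideal Ar Al.
have QN : Q `<=` nonunits A.
  apply: proper_ideal_nonunits => // Q1; apply: (nprQ 1); first exact: oner_neq0.
  by rewrite scale1; apply: ideal_full.
have QE : Q = nonunits A.
  have [->//|[t t0 NE]] := maxQ _ idN QN.
  case: nQ => x Qx.
  have Nt : nonunits A t by rewrite NE; exact: scale_base.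
  have idQ' : is_ideal A (scale t^-1 Q).
    split; last exact: scale_submodule.
    move=> z; rewrite /scale /= invrK => /QN; rewrite NE /scale /=.
    by rewrite mulfK.
  have [z Qz|Q'E|[c c0 Q'E]] := maxQ _ idQ'.
  - by rewrite /scale /= invrK mulrC; apply: QM => //; case: Nt.
  - rewrite -(divfK t0 x) mulrC; apply: ideal_mul_mem => //.
    by rewrite -Q'E /scale /= invrK divfK.
  - case: (nprQ (t * c)); first exact: mulf_neq0.
    by rewrite -scale_scale -Q'E scaleVK.
split=> //; rewrite -QE in nQ *.
have QQ0 : ideal_mul Q Q <> [set 0].
  move=> QQ0; apply: nQ => x Qx.
  have : ideal_mul Q Q (x * x) by exact: ideal_mul_mem.
  rewrite QQ0 /= => /eqP; rewrite mulf_eq0 orbb => /eqP ->.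
  by [].
have idQQ := ideal_mul_ideal Ar idQ idQ.
have [[c c0 E]|[d [Ad d0 E]]] := decQ _ idQQ QQ0.
  have inv : is_invertible A Q.
    exists (scale c^-1 Q); split; last first.
      by rewrite ideal_mul_scaler ?invr_eq0 // E scaleKV.
    split; first exact: scale_submodule.
    exists c; split=> //.
      by case: idQQ => QQA _; apply: QQA; rewrite E; exact: scale_base.
    by move=> x; rewrite /scale /= invrK mulrC; exact: QA.
  by have [e e0 /(nprQ _ e0)] := invertible_principal Ar Al sQ inv.
exists d; split=> //; rewrite QE; split=> // ud.
by apply: nQ; rewrite E (scale_unit sQ ud).
Qed.

(** The ring [V = d^-1 m] is the overring [m : m]. Each nonzero ideal of [A]
is [c A] or [c m], so up to scaling every ideal of [V] is [c V], which makes
[V] a valuation ring; its maximal ideal is still [m]. *)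
Lemma pinched_square_valuation (K : fieldType) (A : set K) d
    (m := nonunits A) (V := scale d^-1 m) :
  is_subring A -> local A -> is_quotient_field A -> pinched A m ->
  m d -> d != 0 -> ideal_mul m m = scale d m ->
  [/\ is_subring V, A `<=` V, valuation V
    & forall x y, V x -> ~ V y -> A (x / y)].
Proof.
move=> Ar Al KA [idm nprm _ decm] md d0 mm.
have [mA sm] := idm; have [m0 mD mM] := sm.
have VE x : V x = m (x * d) by rewrite /V /scale /= invrK.
have mV x : m x = V (x / d) by rewrite VE divfK.
have mVm x y : m x -> V y -> m (x * y).
  rewrite VE => mx myd; have : ideal_mul m m (x * (y * d)).
    exact: ideal_mul_mem.
  by rewrite mm /scale /= mulrA mulfK.
have AV : A `<=` V by move=> x Ax; rewrite VE; exact: mM.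
have Vr : is_subring V.
  apply: subring_of_laws.
  - by rewrite VE mul1r.
  - move=> x y; rewrite !VE mulrBl => mx my; apply: mD => //.
    by rewrite -mulN1r; apply: mM => //; apply: subringN => //; exact: subring1.
  - by move=> x y Vx Vy; rewrite VE mulrAC; apply: mVm => //; rewrite -VE.
have Vunit x : V x -> m x \/ units V x.
  move=> Vx; have [->|x0] := eqVneq x 0; first by left.
  have xm : scale x m (d * x) by rewrite /scale /= mulfK.
  have idxm : is_ideal A (scale x m).
    split; last exact: scale_submodule.
    by move=> z mz; apply: mA; rewrite -(divfK x0 z); exact: mVm.
  have xm0 : scale x m <> [set 0].
    by move=> E; move: xm; rewrite E => /eqP; rewrite mulf_eq0 (negPf d0) (negPf x0).
  have [[c c0 E]|[c [Ac c0 E]]] := decm _ idxm xm0.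
    case: (nprm (x^-1 * c)); first by rewrite mulf_neq0 ?invr_eq0.
    by rewrite -scale_scale -E scaleKV.
  have Vxc : V (x / c).
    by rewrite VE mulrAC [x * d]mulrC; move: xm; rewrite E.
  have Vcx : V (c / x).
    have : scale c m (d * c) by rewrite /scale /= mulfK.
    by rewrite -E VE mulrAC [c * d]mulrC.
  have [uc|nuc] := pselect (units A c).
    right; split=> //; have [_ _ Ac'] := uc.
    have -> : x^-1 = c / x * c^-1 by field; rewrite x0 c0.
    by apply: subringM => //; exact: AV.
  by left; rewrite -(divfK c0 x) mulrC; apply: mVm.
have Vl : local V.
  move=> x Vx; case: (Vunit x Vx) => [mx|]; last by left.
  have V1x : V (1 - x) by apply: subringB => //; exact: subring1.
  case: (Vunit _ V1x) => [m1x|]; last by right.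
  by case: (nonunits1 Ar); rewrite -[1](subrK x); exact: mD.
have Vv : valuation V.
  apply: local_bezout_valuation => //; first exact: quotient_field_subset KA.
  move=> x y Vx Vy x0 y0; set P := pair_ideal V x y.
  have sP : is_submodule V P by exact: pair_ideal_submodule.
  have [_ _ PM] := sP.
  have PV : P `<=` V by apply: pair_ideal_sub => //; exact: subring_submodule.
  have iddP : is_ideal A (scale d P).
    split; first by move=> z /PV; rewrite -mV => /mA.
    by apply: scale_submodule; exact: submodule_restrict sP.
  have dP0 : scale d P <> [set 0].
    move=> E; have : scale d P (x * d).
      by rewrite /scale /= mulfK //; exact: pair_ideal_left.
    by rewrite E => /eqP; rewrite mulf_eq0 (negPf d0) (negPf x0).
  have PE : P = scale d^-1 (scale d P) by rewrite scaleKV.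
  have [[c c0 E]|[c [Ac c0 E]]] := decm _ iddP dP0.
    have cd0 : d^-1 * c != 0 by rewrite mulf_neq0 ?invr_eq0.
    rewrite E scale_scale in PE; exists (d^-1 * c) => //.
    have Pc : P (d^-1 * c) by rewrite PE; exact: scale_base.
    apply/seteqP; split; first by rewrite PE => z /AV.
    by move=> z Vz; rewrite -(divfK cd0 z); exact: PM.
  by exists c => //; rewrite PE E !scale_scale mulrC.
split=> // x y Vx nVy.
have Vy' : V y^-1 by case: (Vv y).
case: (Vunit _ Vy') => [my|[_ _]]; last by rewrite invrK.
by rewrite mulrC; apply: mA; exact: mVm.
Qed.

(** If [A] is not itself a valuation ring, let [V = m : m] be the valuation
ring obtained from [m * m = d m]. An overring [B] not contained in
[V] has an element of negative value, and so contains [V] because the elements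
of positive value already lie in [A]. Otherwise [d B] is an ideal of [A],
either [c A] or [c m], which leaves [B = A] or [B = V]. *)
Lemma pinched_overring_local (K : fieldType) (A Q B : set K) :
  is_subring A -> local A -> is_quotient_field A -> pinched A Q ->
  overrings A B -> local B.
Proof.
move=> Ar Al KA pQ [Br AB].
have [QmQ|nQ] := pselect (Q `<=` ideal_mul (nonunits A) Q).
  apply: valuation_local => //.
  exact: valuation_overring (pinched_nakayama_valuation Ar Al KA pQ QmQ) AB.
have [QE [d [md d0 mm]]] := pinched_square Ar Al pQ nQ.
rewrite {}QE in pQ mm; have [_ _ _ decm] := pQ.
have [Vr AV Vv VA] := pinched_square_valuation Ar Al KA pQ md d0 mm.
set V := scale _ _ in Vr AV Vv VA.
have [BV|/existsNP[b /not_implyP[Bb nVb]]] := pselect (B `<=` V); last first.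
  apply: valuation_local => //; apply: valuation_overring Vv _ => x Vx.
  have b0 : b != 0 by apply/eqP => b0; apply: nVb; rewrite b0; exact: subring0.
  by rewrite -(divfK b0 x); apply: subringM => //; apply: AB; exact: VA.
have iddB : is_ideal A (scale d B).
  split; first by move=> x /BV; rewrite /V /scale /= invrK divfK // => -[].
  apply: scale_submodule; apply: submodule_restrict AB _.
  exact: subring_submodule.
have dB0 : scale d B <> [set 0].
  move=> E; have := scale_base Br d0; rewrite E => /eqP.
  by rewrite (negPf d0).
have BE : B = scale d^-1 (scale d B) by rewrite scaleKV.
have [[c c0 E]|[c [Ac c0 E]]] := decm _ iddB dB0.
  rewrite E scale_scale in BE; set y := d^-1 * c in BE.
  have y0 : y != 0 by rewrite mulf_neq0 ?invr_eq0.
  have By : B y by rewrite BE; exact: scale_base.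
  have Ay : A y.
    have : B (y * y) by exact: subringM.
    by rewrite BE /scale /= mulfK.
  suff -> : B = A by [].
  apply/seteqP; split=> // x; rewrite BE /scale /= => Axy.
  by rewrite -(divfK y0 x); exact: subringM.
have {}BE : B = scale c V by rewrite BE E /V !scale_scale mulrC.
suff -> : B = V by exact: valuation_local.
apply/seteqP; split=> // x Vx; rewrite BE /scale /=.
apply: subringM => //; have := subring1 Br.
by rewrite BE /scale /= mul1r.
Qed.

(** * Quasi-local overrings *)

(** The maximal ideal of [B] contracts to a prime of [D], which lies in some
maximal ideal [M]; elements of [D] outside [M] are then units of [B]. *)
Lemma quasi_local_overring_localization (K : fieldType) (D B : set K) :
  is_subring D -> ql_overrings D B ->
  exists2 M, Max D M & localization D M `<=` B.
Proof.
move=> Dr [[Br DB] [N [mN uniqN]]].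
have [[NB [N0 ND NM]] NnB _] := mN.
have N1 : ~ N 1 by case: mN => idN _ _ /(ideal_full idN).
have [|[_ /N1]//|M mM PM] := @exists_maximal_ideal _ D (D `&` N) Dr.
  split=> [x []//|]; split.
  - by split=> //; exact: subring0.
  - by move=> x y [Dx Nx] [Dy Ny]; split; [exact: subringD|exact: ND].
  - by move=> a x Da [Dx Nx]; split; [exact: subringM|apply: NM => //; exact: DB].
exists M => // _ [a [s [Da Ds Ms ->]]].
apply: subringM => //; first exact: DB.
apply: contrapT => nBs.
have s0 : s != 0.
  by apply/eqP => s0; apply: Ms; rewrite s0; case: mM => -[_ []].
have idsB := principal_ideal Br (DB _ Ds).
have [[b Bb E1]|N' mN' sN'] := exists_maximal_ideal Br idsB.
  by apply: nBs; rewrite -[s^-1]mul1r E1 mulfK.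
apply: Ms; apply: PM; split=> //; rewrite (uniqN _ mN'); apply: sN'.
by exists 1; [exact: subring1 | rewrite mul1r].
Qed.

Theorem lemma5 (K : fieldType) (D : set K)
    (D_subring : is_subring D) (K_quotient : is_quotient_field D)
    (D_GMPD : is_GMPD D) :
  ql_overrings D = \bigcup_(M in Max D) overrings (localization D M).
Proof.
have [_ D_MPD] := D_GMPD; apply/seteqP; split=> B.
  move=> qlB; have [M mM DMB] := quasi_local_overring_localization D_subring qlB.
  by exists M => //; split=> //; case: qlB => -[].
move=> [M mM [Br DMB]].
have DDM := localization_superset D_subring mM.
have DMr := localization_subring D_subring mM.
have DMl := localization_local D_subring mM.
split; first by split=> //; exact: subset_trans DMB.
apply: local_quasi_local => //.
have [Q pQ] := MPD_pinched DMr DMl (D_MPD M mM).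
by apply: (pinched_overring_local DMr DMl _ pQ); first exact: quotient_field_subset K_quotient.
Qed.
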